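(* Fix $\epsilon>0$. There is $n_0(\epsilon)$ such that for all $n\geq n_0(\epsilon)$ the following holds. Let $N=2^n$, let $k$ be an integer with $\epsilon N\le k\le N$, and let $k'$ be the power of $2$ satisfying $k'<k\leq 2k'$. Then there is a family $\mathcal{F}$ of subsets of $\mathbb{F}_2^n$ such that (i) $|\mathcal{F}|\leq 2^{\epsilon N}$; (ii) every $F\in \mathcal{F}$ has at least $(2-\epsilon)k'$ elements; (iii) for every $X\subset \mathbb{F}_2^n$ with $|X|=k$, there is $F\in \mathcal{F}$ such that $F\subset X+X$.
   Context: $X+X=\{x_1+x_2\colon x_1,x_2\in X\}$ denotes the sumset in $\mathbb{F}_2^n$. *)

(* Defs.v *)
From mathcomp Require Import all_boot all_order all_algebra.
Set Implicit Arguments. Unset Strict Implicit. Unset Printing Implicit Defensive.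
Import Order.TTheory GRing.Theory.
Local Open Scope ring_scope.

Definition sumset (T : finZmodType) (X : {set T}) : {set T} :=
  [set x1 + x2 | x1 in X, x2 in X].

(* Main.v *)
(* Energy increment produces a subspace V (the kernel of a matrix M) of bounded
   codimension on almost all of whose cosets X has no large Fourier coefficient.
   If U is a union of V-cosets nearly filled by X + X, then X + X contains U
   minus a small set; such sets are cheap to count, since there are few matrices,
   few unions of cosets and few small sets. To see that U can be taken of size
   almost 2k', one uses |A + B| >= 2^j + |B| whenever |B| <= 2^j < |A|, which a
   Combinatorial Nullstellensatz argument in characteristic 2 provides: it is
   applied to the union U0 of the dense regular cosets when |U0| > k'; otherwise
   X has density near 1 on almost all of U0, which makes single translates of
   U0 by points of X nearly full, and it is applied to X and U0. *)

Require Import Defs.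
From mathcomp Require Import all_boot all_order all_algebra.
From mathcomp Require Import all_classical all_reals all_analysis.
From mathcomp Require Import ring lra zify.
Set Implicit Arguments. Unset Strict Implicit. Unset Printing Implicit Defensive.
Import Order.TTheory GRing.Theory Num.Theory.
Local Open Scope ring_scope.

(** * Sumsets and powers of two *)

Lemma vandermonde_weights (D : idomainType) (m : nat) (a : 'I_m.+1 -> D) :
  injective a ->
  exists w : 'I_m.+1 -> D, exists2 c, c != 0 &
    forall i, (i <= m)%N -> \sum_j w j * a j ^+ i = c *+ (i == m).
Proof.
move=> inja; pose r : 'rV_m.+1 := \row_j a j.
pose V := Vandermonde m.+1 r.
exists (fun j => \adj V j ord_max), (\det V).
  rewrite det_Vandermonde; apply/prodf_neq0 => i _; apply/prodf_neq0 => j ltij.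
  rewrite subr_eq0 !mxE; apply/eqP => /inja eji.
  by rewrite eji ltnn in ltij.
move=> i lei; have /matrixP/(_ (Ordinal (lei : (i < m.+1)%N)) ord_max) := mul_mx_adj V.
rewrite !mxE => <-; apply: eq_bigr => j _.
by rewrite !mxE mulrC.
Qed.

(* A two-variable Combinatorial Nullstellensatz for [P(x + y)]: pairing with
   weights that kill all powers below the top one isolates the coefficient of
   [x ^ p * y ^ q]. *)
Lemma nullstellensatz_add (D : idomainType) (p q : nat) (a : 'I_p.+1 -> D)
    (b : 'I_q.+1 -> D) (P : {poly D}) :
  injective a -> injective b -> size P = (p + q).+1 ->
  'C(p + q, q)%:R != 0 :> D -> exists i j, P.[a i + b j] != 0.
Proof.
move=> inja injb szP binN0; apply: contrapT => noP.
have P0 i j : P.[a i + b j] = 0.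
  by apply/eqP/negPn/negP => Pn0; apply: noP; exists i, j.
have [w [c c0 wE]] := vandermonde_weights inja.
have [v [d d0 vE]] := vandermonde_weights injb.
have : \sum_i \sum_j w i * v j * P.[a i + b j] = 0.
  by apply: big1 => i _; apply: big1 => j _; rewrite P0 mulr0.
suff -> : \sum_i \sum_j w i * v j * P.[a i + b j] =
          lead_coef P * 'C(p + q, q)%:R * (c * d).
  by move/eqP; rewrite !mulf_eq0 (negPf binN0) (negPf c0) (negPf d0)
     lead_coef_eq0 -size_poly_eq0 szP.
have E i j : w i * v j * P.[a i + b j] = \sum_(m < (p + q).+1)
    \sum_(l < m.+1) P`_m *+ 'C(m, l) * ((w i * a i ^+ (m - l)) * (v j * b j ^+ l)).
  rewrite horner_coef szP mulr_sumr; apply: eq_bigr => m _.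
  rewrite exprDn !mulr_sumr; apply: eq_bigr => l _.
  by rewrite mulrnAl !mulrnAr; congr (_ *+ _); ring.
under eq_bigr => i _ do under eq_bigr => j _ do rewrite E.
under eq_bigr => i _ do rewrite exchange_big /=.
rewrite exchange_big /=.
have F (m : 'I_(p + q).+1) : \sum_i \sum_j \sum_(l < m.+1)
   P`_m *+ 'C(m, l) * ((w i * a i ^+ (m - l)) * (v j * b j ^+ l)) =
   \sum_(l < m.+1) P`_m *+ 'C(m, l) *
     ((\sum_i w i * a i ^+ (m - l)) * (\sum_j v j * b j ^+ l)).
  under eq_bigr => i _ do rewrite exchange_big /=.
  rewrite exchange_big /=; apply: eq_bigr => l _.
  rewrite mulr_suml mulr_sumr; apply: eq_bigr => i _.
  by rewrite -mulr_sumr -mulr_sumr.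
under eq_bigr => m _ do rewrite F.
(* The weights kill exponents of [a] below [p] and of [b] below [q]; as [m <= p + q], only
   [m = p + q], [l = q] escapes. *)
have Z (m l : nat) : (m < (p + q).+1)%N -> (l < m.+1)%N ->
    ~~ ((m == (p + q)%N) && (l == q)) ->
    (\sum_i w i * a i ^+ (m - l)) * (\sum_j v j * b j ^+ l) = 0.
  move=> lem lel nml; have [lep|ltp] := ltnP (m - l) p.
    by rewrite wE 1?ltnW // (ltn_eqF lep) mul0r.
  have ltq : (l < q)%N by move: nml; lia.
  by rewrite vE 1?ltnW // (ltn_eqF ltq) mulr0.
rewrite (bigD1 ord_max) //= [X in _ + X]big1 ?addr0 => [|m nm]; last first.
  apply: big1 => l _; rewrite Z ?mulr0 // negb_and; apply/orP; left.
  by apply: contraNN nm => /eqP e; apply/eqP/val_inj.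
have ltq : (q < (p + q).+1)%N by lia.
rewrite (bigD1 (Ordinal ltq)) //= [X in _ + X]big1 ?addr0 => [|l nl]; last first.
  rewrite Z ?mulr0 // eqxx /=.
  by apply: contraNN nl => /eqP e; apply/eqP/val_inj.
rewrite addnK wE // vE // !eqxx !mulr1n lead_coefE szP /=.
by rewrite -[P`_(p + q) *+ _]mulr_natr.
Qed.

Lemma pchar_polyF2 : 2%N \in [pchar {poly 'F_2}].
Proof. by rewrite pchar_poly; exact: pchar_Fp. Qed.

(** By Frobenius, [(X + 1) ^ (2 ^ j + t) = (X ^ (2 ^ j) + 1) * (X + 1) ^ t]; as [t < 2 ^ j], the
    coefficient at [X ^ t] is 1. *)
Lemma binomial_pow2_neq0 (j t : nat) :
  (t < 2 ^ j)%N -> 'C(2 ^ j + t, t)%:R != 0 :> {poly 'F_2}.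
Proof.
move=> ltt; have c2 : 2%N \in [pchar 'F_2] by exact: pchar_Fp.
have coefE (n i : nat) : (('X + 1) ^+ n : {poly 'F_2})`_i = 'C(n, i)%:R.
  rewrite addrC exprDn coef_sum.
  under eq_bigr => l _ do rewrite expr1n mul1r coefMn coefXn.
  have [lti|lei] := ltnP i n.+1.
    rewrite (bigD1 (Ordinal lti)) //= eqxx big1 ?addr0 // => l nl.
    case: eqP => [e|_]; last by rewrite mul0rn.
    by case/eqP: nl; apply/val_inj.
  rewrite bin_small // big1 // => l _.
  by case: eqP => [e|_]; [move: (ltn_ord l); lia | rewrite mul0rn].
have : (('X + 1) ^+ (2 ^ j + t) : {poly 'F_2})`_t = 1.
  rewrite exprD exprDn_pchar ?expr1n; last first.
    by rewrite pnatX (pnatE _ (isT : prime 2)) pchar_polyF2.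
  by rewrite mulrDl mul1r coefD coefXnM ltt add0r coefE binn.
by rewrite coefE -polyC_natr polyC_eq0 => ->; rewrite oner_eq0.
Qed.

Lemma injective_enum (T : finType) (A : {set T}) (m : nat) :
  (m < #|A|)%N -> exists2 f : 'I_m.+1 -> T, injective f & forall i, f i \in A.
Proof.
move=> ltm; have le i : (i < m.+1 -> i < #|A|)%N by lia.
exists (fun i => enum_val (Ordinal (le _ (ltn_ord i)))) => [i j /enum_val_inj|i].
  by case=> /val_inj.
exact: enum_valP.
Qed.

(* [rVpoly] embeds the group in the additive group of a domain of
   characteristic 2, where a sumset of smaller size would be the zero set of a
   polynomial of degree [2 ^ j + #|B| - 1], whose coefficient
   ['C(2 ^ j + #|B| - 1, 2 ^ j)] is odd. *)
Lemma card_sumset_pow2 (n j : nat) (A B : {set 'rV['F_2]_n}) :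
  (2 ^ j < #|A|)%N -> (0 < #|B|)%N -> (#|B| <= 2 ^ j)%N ->
  (2 ^ j + #|B| <= #|[set (a + b)%R | a in A, b in B]|)%N.
Proof.
move=> ltA; case EB : #|B| => [//|t] _ leB; rewrite leqNgt; apply/negP => ltS.
set S := [set _ | _ in _, _ in _] in ltS.
have [a inja aA] := injective_enum ltA.
have [b injb bB] : exists2 f : 'I_t.+1 -> _, injective f & forall i, f i \in B.
  by apply: injective_enum; rewrite EB.
have injh : injective (@rVpoly 'F_2 n) by exact: can_inj rVpolyK.
(* The power of ['X] pads the degree to exactly [2 ^ j + t]; additional zeros are harmless. *)
pose P : {poly {poly 'F_2}} :=
  'X ^+ (2 ^ j + t - #|S|) * \prod_(c in S) ('X - (rVpoly c)%:P).
have szP : size P = (2 ^ j + t).+1.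
  rewrite size_monicM ?monicXn ?monic_neq0 ?monic_prod_XsubC //.
  by rewrite size_polyXn -big_enum size_prod_XsubC -cardE; lia.
have [] := @nullstellensatz_add _ _ _ (@rVpoly 'F_2 n \o a) (@rVpoly 'F_2 n \o b)
  P _ _ szP (binomial_pow2_neq0 leB).
- exact: inj_comp.
- exact: inj_comp.
move=> i [k]; rewrite /= -raddfD /P hornerM horner_prod.
rewrite (bigD1 (a i + b k)) /=; last by apply/imset2P; exists (a i) (b k).
by rewrite hornerXsubC subrr mul0r mulr0 eqxx.
Qed.

(** * Fourier analysis *)

(** Lagrange's identity: twice the gap is the double sum of [(a i * b j - a j * b i) ^+ 2]. *)
Lemma cauchy_schwarz_sum (R : realFieldType) (I : finType) (P : pred I)
    (a b : I -> R) :
  (\sum_(i | P i) a i * b i) ^+ 2 <=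
  (\sum_(i | P i) a i ^+ 2) * (\sum_(i | P i) b i ^+ 2).
Proof.
have : 0 <= \sum_(i | P i) \sum_(j | P j) (a i * b j - a j * b i) ^+ 2.
  by apply: sumr_ge0 => i _; apply: sumr_ge0 => j _; exact: sqr_ge0.
have -> : \sum_(i | P i) \sum_(j | P j) (a i * b j - a j * b i) ^+ 2 =
    \sum_(i | P i) \sum_(j | P j) a i ^+ 2 * b j ^+ 2
  + \sum_(i | P i) \sum_(j | P j) b i ^+ 2 * a j ^+ 2
  - 2 * (\sum_(i | P i) \sum_(j | P j) (a i * b i) * (a j * b j)).
  rewrite mulr_sumr -sumrN -!big_split /=; apply: eq_bigr => i _.
  rewrite mulr_sumr -sumrN -!big_split /=; apply: eq_bigr => j _.
  ring.
rewrite -!big_distrlr /= expr2; lra.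
Qed.

Lemma addrr_F2 (n : nat) (x : 'rV['F_2]_n) : x + x = 0.
Proof. by apply/rowP => i; rewrite !mxE (addrr_pchar2 (pchar_Fp _)). Qed.

Lemma oppr_F2 (n : nat) (x : 'rV['F_2]_n) : - x = x.
Proof. by apply/eqP; rewrite eq_sym -subr_eq0 opprK addrr_F2. Qed.

Lemma card_rowF2 (n : nat) : #|{: 'rV['F_2]_n}| = (2 ^ n)%N.
Proof. by rewrite card_mx card_Fp // mul1n. Qed.

Section Fourier.
Context {R : realType} {n : nat}.
Implicit Types (xi : 'cV['F_2]_n) (x y : 'rV['F_2]_n) (f : 'rV['F_2]_n -> R).

Definition chi xi x : R := (-1) ^+ ((x *m xi) 0 0 : 'F_2).

Lemma signF2D (a b : 'F_2) : (-1) ^+ (a + b)%R = (-1) ^+ a * (-1) ^+ b :> R.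
Proof. by case: a => [[|[|//]] ?]; case: b => [[|[|//]] ?] /=; lra. Qed.

Lemma chiDr xi x y : chi xi (x + y) = chi xi x * chi xi y.
Proof. by rewrite /chi mulmxDl mxE signF2D. Qed.

Lemma chiDl xi xi' x : chi (xi + xi') x = chi xi x * chi xi' x.
Proof. by rewrite /chi mulmxDr mxE signF2D. Qed.

Lemma chi_sqr xi x : chi xi x ^+ 2 = 1.
Proof. by rewrite expr2 -chiDr addrr_F2 /chi mul0mx mxE. Qed.

Lemma sum_chi x : \sum_xi chi xi x = (2 ^ n)%:R * (x == 0)%:R.
Proof.
have [->|] := eqVneq x 0.
  under eq_bigr do rewrite /chi mul0mx mxE expr0.
  by rewrite sumr_const card_mx card_Fp // muln1 mulr1.
move=> /rV0Pn[i xi0]; rewrite mulr0.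
(* Translating [xi] along a coordinate where [x] is nonzero flips the sign of the sum. *)
have e : chi (delta_mx i 0) x = -1.
  rewrite /chi -colE mxE.
  by case: (x 0 i) xi0 => [[|[|//]] ?] //= _; rewrite expr1.
have : \sum_xi chi xi x = - \sum_xi chi xi x.
  rewrite [LHS](reindex_inj (addIr (delta_mx i 0))) /= -sumrN.
  by apply: eq_bigr => xi _; rewrite chiDl e mulrN1.
lra.
Qed.

Definition fourier f xi : R := \sum_x f x * chi xi x.

Lemma parseval f : \sum_xi fourier f xi ^+ 2 = (2 ^ n)%:R * \sum_x f x ^+ 2.
Proof.
have E xi : fourier f xi ^+ 2 = \sum_x \sum_y f x * f y * chi xi (x + y).
  rewrite expr2 mulr_suml; apply: eq_bigr => x _.
  by rewrite mulr_sumr; apply: eq_bigr => y _; rewrite chiDr; ring.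
under eq_bigr do rewrite E; rewrite exchange_big /= mulr_sumr.
apply: eq_bigr => x _; rewrite exchange_big /=.
under eq_bigr do rewrite -mulr_sumr sum_chi.
rewrite (bigD1 x) //= addrr_F2 eqxx mulr1 big1 ?addr0 => [|y nyx]; first by ring.
by rewrite addr_eq0 oppr_F2 eq_sym (negPf nyx) !mulr0.
Qed.

Lemma sum_fourier3 (f g h : 'rV['F_2]_n -> R) :
  \sum_xi fourier f xi * (fourier g xi * fourier h xi) =
  (2 ^ n)%:R * \sum_y \sum_z f (y + z) * (g y * h z).
Proof.
have E xi : fourier f xi * (fourier g xi * fourier h xi) =
    \sum_y \sum_z \sum_x f x * (g y * h z) * chi xi (x + y + z).
  rewrite [X in _ * X]big_distrlr /= mulr_sumr; apply: eq_bigr => y _.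
  rewrite mulr_sumr; apply: eq_bigr => z _.
  rewrite mulr_suml; apply: eq_bigr => x _.
  by rewrite !chiDr; ring.
under eq_bigr do rewrite E; rewrite exchange_big /= mulr_sumr.
apply: eq_bigr => y _; rewrite exchange_big /= mulr_sumr.
apply: eq_bigr => z _; rewrite exchange_big /=.
under eq_bigr do rewrite -mulr_sumr sum_chi.
rewrite (bigD1 (y + z)) //= -addrA addrr_F2 eqxx mulr1 big1 ?addr0 => [|x nx].
  by ring.
by rewrite -addrA addr_eq0 oppr_F2 (negPf nx) !mulr0.
Qed.

(** Cauchy-Schwarz on the Fourier side needs the uniform bound for [f] alone; Parseval handles [g]
    and [h]. *)
Lemma convolution_fourier_bound (f g h : 'rV['F_2]_n -> R) (C : R) :
  (forall xi, fourier f xi ^+ 2 <= C) ->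
  (\sum_y \sum_z f (y + z) * (g y * h z)) ^+ 2 <=
  C * ((\sum_y g y ^+ 2) * (\sum_z h z ^+ 2)).
Proof.
move=> leC; have N0 : 0 < (2 ^ n)%:R ^+ 2 :> R by rewrite exprn_gt0 // ltr0n expn_gt0.
rewrite -(ler_pM2l N0) -exprMn -sum_fourier3.
under eq_bigr do rewrite mulrA.
apply: le_trans (cauchy_schwarz_sum _ _ _) _.
have -> : (2 ^ n)%:R ^+ 2 * (C * ((\sum_y g y ^+ 2) * (\sum_z h z ^+ 2))) =
    C * (\sum_xi fourier g xi ^+ 2) * (\sum_xi fourier h xi ^+ 2).
  by rewrite !parseval; ring.
apply: ler_wpM2r; first by apply: sumr_ge0 => xi _; exact: sqr_ge0.
rewrite mulr_sumr; apply: ler_sum => xi _; rewrite exprMn.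
by apply: ler_wpM2r (leC xi); exact: sqr_ge0.
Qed.

End Fourier.

(** * Regularity relative to a subspace *)

Section Averages.
Context {R : realType} {n : nat}.
Implicit Types (x y : 'rV['F_2]_n) (f g : 'rV['F_2]_n -> R).

(** A subspace is encoded as the kernel of [M]: its cosets are the sets where [x *m M] is constant,
    and its codimension is at most the number [d] of columns. *)
Definition fiber_card d (M : 'M['F_2]_(n, d)) : R := #|[set y : 'rV['F_2]_n | y *m M == 0]|%:R.

Definition avg d (M : 'M['F_2]_(n, d)) f x : R :=
  (\sum_(y : 'rV['F_2]_n | y *m M == x *m M) f y) / fiber_card M.

Definition invariant_fun T d (M : 'M['F_2]_(n, d)) (g : 'rV['F_2]_n -> T) :=
  forall x y, x *m M = y *m M -> g x = g y.

Lemma card_fiber d (M : 'M['F_2]_(n, d)) x :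
  #|[set y : 'rV['F_2]_n | y *m M == x *m M]|%:R = fiber_card M.
Proof.
rewrite /fiber_card -[in RHS](card_imset _ (addrI x)); congr (_%:R).
apply: eq_card => y; rewrite inE; apply/eqP/imsetP => [e|[z]].
  by exists (y - x); rewrite ?inE ?mulmxBl ?e ?subrr // addrC subrK.
by rewrite inE => /eqP z0 ->; rewrite mulmxDl z0 addr0.
Qed.

Lemma fiber_card_gt0 d (M : 'M['F_2]_(n, d)) : 0 < fiber_card M.
Proof. by rewrite ltr0n; apply/card_gt0P; exists 0; rewrite inE mul0mx. Qed.

Lemma sum_fiber d (M : 'M['F_2]_(n, d)) f x :
  \sum_(y : 'rV['F_2]_n | y *m M == x *m M) f y = fiber_card M * avg M f x.
Proof. by rewrite /avg mulrC divfK // gt_eqF // fiber_card_gt0. Qed.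

Lemma sum_fiber_cst d (M : 'M['F_2]_(n, d)) (c : R) x :
  \sum_(y : 'rV['F_2]_n | y *m M == x *m M) c = c * fiber_card M.
Proof.
rewrite sumr_const -mulr_natr -(card_fiber M x); congr (_ * _%:R).
by apply: eq_card => y; rewrite !inE.
Qed.

Lemma avg_inv d (M : 'M['F_2]_(n, d)) f : invariant_fun M (avg M f).
Proof. by move=> x y e; rewrite /avg e. Qed.

Lemma avg_cst d (M : 'M['F_2]_(n, d)) (c : R) x : avg M (fun=> c) x = c.
Proof.
by rewrite /avg sum_fiber_cst mulfK // gt_eqF // fiber_card_gt0.
Qed.

Lemma le_avg d (M : 'M['F_2]_(n, d)) f g x :
  (forall y, y *m M = x *m M -> f y <= g y) -> avg M f x <= avg M g x.
Proof.
move=> le; rewrite ler_pM2r ?invr_gt0 ?fiber_card_gt0 //.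
by apply: ler_sum => y /eqP; exact: le.
Qed.

(** [avg M] is the orthogonal projection onto the functions constant on cosets, hence
    self-adjoint. *)
Lemma avg_dual d (M : 'M['F_2]_(n, d)) f g : invariant_fun M g ->
  \sum_x avg M f x * g x = \sum_x f x * g x.
Proof.
move=> invg; under eq_bigr do rewrite /avg mulr_suml mulr_suml.
rewrite (exchange_big_dep predT) //=; apply: eq_bigr => y _.
rewrite (eq_bigr (fun=> f y / fiber_card M * g y)) => [|x /eqP /invg -> //].
under eq_bigl do rewrite eq_sym.
by rewrite sum_fiber_cst mulrAC divfK // gt_eqF // fiber_card_gt0.
Qed.

Lemma sum_avg d (M : 'M['F_2]_(n, d)) f : \sum_x avg M f x = \sum_x f x.
Proof.
have := @avg_dual _ M f (fun=> 1) (fun _ _ _ => erefl).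
by under eq_bigr do rewrite mulr1; under [RHS]eq_bigr do rewrite mulr1.
Qed.

Lemma avg_ge0 d (M : 'M['F_2]_(n, d)) f x : (forall y, 0 <= f y) -> 0 <= avg M f x.
Proof. by move=> f0; rewrite -(avg_cst M 0 x); apply: le_avg. Qed.

Lemma avg_le1 d (M : 'M['F_2]_(n, d)) f x : (forall y, f y <= 1) -> avg M f x <= 1.
Proof. by move=> f1; rewrite -[leRHS](avg_cst M 1 x); apply: le_avg. Qed.

Definition energy d (M : 'M['F_2]_(n, d)) f : R := \sum_x avg M f x ^+ 2.

Lemma energy_le d (M : 'M['F_2]_(n, d)) f : (forall y, 0 <= f y <= 1) ->
  energy M f <= (2 ^ n)%:R.
Proof.
move=> f01; apply: (@le_trans _ _ (\sum_(x : 'rV['F_2]_n) 1)).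
  apply: ler_sum => x _; apply: exprn_ile1.
    by apply: avg_ge0 => y; case/andP: (f01 y).
  by apply: avg_le1 => y; case/andP: (f01 y).
by rewrite sumr_const card_rowF2.
Qed.

(** Pythagoras: [avg M f] is the projection of [avg M' f] onto a smaller space. *)
Lemma energy_refine d d' (M : 'M['F_2]_(n, d)) (M' : 'M['F_2]_(n, d')) f :
  (forall x y, x *m M' = y *m M' -> x *m M = y *m M) ->
  \sum_x (avg M' f x - avg M f x) ^+ 2 = energy M' f - energy M f.
Proof.
move=> ref; have inv' : invariant_fun M' (avg M f).
  by move=> x y /ref; exact: avg_inv.
have E1 : \sum_x avg M' f x * avg M f x = energy M f.
  rewrite (avg_dual _ inv') -(avg_dual _ (@avg_inv _ M f)).
  by apply: eq_bigr => x _; rewrite expr2.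
under eq_bigr => x _ do rewrite sqrrB.
by rewrite big_split sumrB /= sumrMnl E1 /energy; lra.
Qed.

(** The cosets on which the balanced function has a Fourier coefficient whose square, normalised by
    the coset size, is at least [t]. *)
Definition biased d (M : 'M['F_2]_(n, d)) f (t : R) : {set 'rV['F_2]_n} :=
  [set x | [exists xi, t * fiber_card M ^+ 2 <=
    (\sum_(y : 'rV['F_2]_n | y *m M == x *m M) (f y - avg M f y) * chi xi y) ^+ 2]].

(** One witnessing frequency per coset is appended as a column. Its character is constant on the
    finer cosets, so a biased coset forces [avg M' f] away from [avg M f]. *)
Lemma biased_refine d (M : 'M['F_2]_(n, d)) f t :
  exists M' : 'M['F_2]_(n, d + #|{: 'rV['F_2]_d}|),
    energy M f + t * #|biased M f t|%:R <= energy M' f.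
Proof.
pose Q (c : 'rV['F_2]_d) (xi : 'cV['F_2]_n) := t * fiber_card M ^+ 2 <=
    (\sum_(y : 'rV['F_2]_n | y *m M == c) (f y - avg M f y) * chi xi y) ^+ 2.
(* The default 0 serves cosets without a witness, where no gain is claimed. *)
pose xi_ c := odflt 0 [pick xi | Q c xi].
have xi_P x : x \in biased M f t -> Q (x *m M) (xi_ (x *m M)).
  rewrite inE => /existsP[xi Qxi]; rewrite /xi_.
  by case: pickP => [//|/(_ xi)]; rewrite {1}/Q Qxi.
pose X : 'M['F_2]_(n, #|{: 'rV['F_2]_d}|) :=
  \matrix_(i, j) xi_ (enum_val j) i 0.
exists (row_mx M X); set M' := row_mx M X.
have XE x c : (x *m X) 0 (enum_rank c) = (x *m xi_ c) 0 0.
  by rewrite !mxE; apply: eq_bigr => i _; rewrite !mxE enum_rankK.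
have ref x y : x *m M' = y *m M' -> x *m M = y *m M.
  by rewrite !mul_mx_row => /eq_row_mx[].
have ref_chi c : invariant_fun M' (chi (R := R) (xi_ c)).
  by move=> x y; rewrite !mul_mx_row => /eq_row_mx[_ e]; rewrite /chi -!XE e.
(* Averaging the energy gain over the cosets of [M] makes the claim local. *)
rewrite -lerBrDl -(energy_refine f ref) -(sum_avg M) mulr_natr -sumr_const.
rewrite big_mkcond /=; apply: ler_sum => x _.
case: ifPn => [xB|_]; last by apply: avg_ge0 => y; exact: sqr_ge0.
have K0 := fiber_card_gt0 M.
rewrite /avg ler_pdivlMr // -(ler_pM2r K0) -mulrA -expr2.
apply: le_trans (xi_P _ xB) _; rewrite /Q; set c := x *m M.
(* Being [M']-invariant, [g] does not distinguish [f] from [avg M' f]. *)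
pose g y : R := (y *m M == c)%:R * chi (xi_ c) y.
have invg : invariant_fun M' g.
  by move=> y z e; rewrite /g (ref _ _ e) (ref_chi c _ _ e).
have toS (h : 'rV['F_2]_n -> R) :
    \sum_(y : 'rV['F_2]_n | y *m M == c) h y * chi (xi_ c) y = \sum_y h y * g y.
  rewrite big_mkcond; apply: eq_bigr => y _; rewrite /g.
  by case: eqP => _; rewrite ?mul1r ?mul0r ?mulr0.
have -> : \sum_(y : 'rV['F_2]_n | y *m M == c) (f y - avg M f y) * chi (xi_ c) y =
          \sum_(y : 'rV['F_2]_n | y *m M == c) (avg M' f y - avg M f y) * chi (xi_ c) y.
  rewrite !toS; under eq_bigr do rewrite mulrBl.
  under [RHS]eq_bigr do rewrite mulrBl.
  by rewrite !sumrB; congr (_ - _); rewrite (avg_dual _ invg).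
apply: le_trans (cauchy_schwarz_sum _ _ _) _; apply: ler_wpM2l.
  by apply: sumr_ge0 => y _; exact: sqr_ge0.
under eq_bigr do rewrite chi_sqr.
by rewrite sum_fiber_cst mul1r.
Qed.

End Averages.

(** Column counts from iterating [biased_refine], starting with no columns; they do not depend on
    [n]. *)
Fixpoint tower_dim (i : nat) : nat :=
  if i is i'.+1 then (tower_dim i' + #|{: 'rV['F_2]_(tower_dim i')}|)%N else 0%N.

Lemma tower_dim_le i j : (i <= j)%N -> (tower_dim i <= tower_dim j)%N.
Proof.
move/subnKC <-; elim: (j - i)%N => [|m IH]; first by rewrite addn0.
by rewrite addnS /=; exact: leq_trans IH (leq_addr _ _).
Qed.

(** Energy increment: each failure gains [t * c * 2 ^ n], while the energy never exceeds [2 ^ n];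
    since [I > 1 / (t * c)], some stage succeeds. *)
Lemma regularity (R : realType) (t c : R) : 0 < t -> 0 < c ->
  exists D : nat, forall (n : nat) (f : 'rV['F_2]_n -> R),
    (forall y, 0 <= f y <= 1) ->
    exists d (M : 'M['F_2]_(n, d)), (d <= D)%N /\
      #|biased M f t|%:R <= c * (2 ^ n)%:R.
Proof.
move=> t0 c0; have tc0 : 0 < t * c by exact: mulr_gt0.
pose I := (Num.truncn (t * c)^-1).+1; exists (tower_dim I) => n f f01.
apply: contrapT => noM.
have {}noM i (M : 'M['F_2]_(n, tower_dim i)) : (i <= I)%N ->
    c * (2 ^ n)%:R < #|biased M f t|%:R.
  move=> lei; rewrite ltNge; apply/negP => le; apply: noM.
  by exists (tower_dim i), M; split => //; exact: tower_dim_le.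
have grow i : (i <= I)%N -> exists M : 'M['F_2]_(n, tower_dim i),
    i%:R * (t * c * (2 ^ n)%:R) <= energy M f.
  elim: i => [_|i IH lti].
    by exists 0; rewrite mul0r; apply: sumr_ge0 => x _; exact: sqr_ge0.
  have [M leM] := IH (ltnW lti).
  have [M' leM'] := biased_refine M f t.
  exists M'; apply: le_trans leM'; rewrite -natr1 mulrDl mul1r.
  apply: lerD leM _; rewrite -mulrA ler_pM2l //.
  exact/ltW/noM/ltnW.
have [M leM] := grow I (leqnn _).
have := le_trans leM (energy_le M f01).
have N0 : 0 < (2 ^ n)%:R :> R by rewrite ltr0n expn_gt0.
rewrite mulrA -{2}[(2 ^ n)%:R]mul1r ler_pM2r // leNgt -ltr_pdivrMr // div1r.
by rewrite truncnS_gt.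
Qed.

(** * Large structured subsets of the sumset *)

Section SumsetStructure.
Context {R : realType} {n : nat}.
Implicit Types (x y : 'rV['F_2]_n) (A B X T U : {set 'rV['F_2]_n}).

Definition ind A x : R := (x \in A)%:R.

Lemma ind01 A x : 0 <= ind A x <= 1.
Proof. by rewrite /ind ler0n lern1 leq_b1. Qed.

Lemma sum_ind A : \sum_x ind A x = #|A|%:R.
Proof.
rewrite -sum1_card natr_sum [RHS]big_mkcond; apply: eq_bigr => x _.
by rewrite /ind; case: (x \in A).
Qed.

Lemma avg_ind_bound d (M : 'M['F_2]_(n, d)) T (e : R) :
  (forall x, avg M (ind T) x <= e) -> #|T|%:R <= e * (2 ^ n)%:R.
Proof.
move=> le; rewrite -sum_ind -(sum_avg M) -card_rowF2 mulr_natr -sumr_const.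
exact: ler_sum.
Qed.

Lemma avg_shift d (M : 'M['F_2]_(n, d)) (f : 'rV['F_2]_n -> R) x z :
  avg M (fun y => f (y + z)) x = avg M f (x + z).
Proof.
rewrite /avg; congr (_ / _); rewrite [RHS](reindex_inj (addIr z)) /=.
by apply: eq_bigl => y; rewrite !mulmxDl (inj_eq (addIr _)).
Qed.

Lemma invariant_sumset d (M : 'M['F_2]_(n, d)) A B :
  invariant_fun M (mem B) ->
  invariant_fun M (mem [set a + b | a in A, b in B]).
Proof.
move=> invB.
have sub x y : x *m M = y *m M -> x \in [set a + b | a in A, b in B] ->
    y \in [set a + b | a in A, b in B].
  move=> e /imset2P[a b aA bB xE]; apply/imset2P.
  exists a (y - a) => //; last by rewrite addrC subrK.
  suff /invB /= -> : (y - a) *m M = b *m M by [].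
  by rewrite mulmxBl -e xE mulmxDl addrAC subrr add0r.
by move=> x y e /=; apply/idP/idP; apply: sub.
Qed.

(* The balanced function of [X] on the coset of [a] equals minus the density at
   [y + z] whenever [y \in T] and [z \in X], so if [T] were dense in the coset of
   [a + b], this correlation would force a large Fourier coefficient. *)
Lemma avg_sumset_compl d (M : 'M['F_2]_(n, d)) X T a b (delta eta t : R) :
  0 < delta -> 0 < eta -> t <= delta ^+ 3 * eta ->
  (forall x, x \in T -> x \notin sumset X) ->
  a \notin biased M (ind X) t ->
  delta <= avg M (ind X) a -> delta <= avg M (ind X) b ->
  avg M (ind T) (a + b) <= eta.
Proof.
move=> d0 e0 let_ TX nbias lea leb; rewrite leNgt; apply/negP => ltT.
pose K : R := fiber_card M; have K0 : 0 < K := fiber_card_gt0 M.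
(* The three functions live on the cosets of [a], [a + b] and [b], so [y + z] automatically lands in
   the coset of [a]. *)
pose F y := (y *m M == a *m M)%:R * (ind X y - avg M (ind X) y).
pose G y := (y *m M == (a + b) *m M)%:R * ind T y.
pose H y := (y *m M == b *m M)%:R * ind X y.
have sumfib (h : 'rV['F_2]_n -> R) c :
    \sum_y (y *m M == c *m M)%:R * h y = K * avg M h c.
  rewrite -sum_fiber [RHS]big_mkcond; apply: eq_bigr => y _.
  by case: eqP => _; rewrite ?mul1r ?mul0r.
have sqG : \sum_y G y ^+ 2 = K * avg M (ind T) (a + b).
  rewrite -sumfib; apply: eq_bigr => y _; rewrite /G /ind.
  by case: eqP => _; case: (y \in T); rewrite ?mul0r ?mulr0 ?mulr1 ?expr0n ?expr1n.
have sqH : \sum_y H y ^+ 2 = K * avg M (ind X) b.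
  rewrite -sumfib; apply: eq_bigr => y _; rewrite /H /ind.
  by case: eqP => _; case: (y \in X); rewrite ?mul0r ?mulr0 ?mulr1 ?expr0n ?expr1n.
have leF xi : fourier F xi ^+ 2 <= t * K ^+ 2.
  apply: ltW; rewrite ltNge; apply/negP => le; case/negP: nbias.
  rewrite inE; apply/existsP; exists xi; apply: le_trans le _.
  rewrite le_eqVlt; apply/orP; left; apply/eqP; congr (_ ^+ 2).
  rewrite [RHS]big_mkcond; apply: eq_bigr => y _; rewrite /F.
  by case: eqP => _; rewrite ?mul1r ?mul0r.
have := convolution_fourier_bound G H leF; rewrite sqG sqH.
have -> : \sum_y \sum_z F (y + z) * (G y * H z) =
    - avg M (ind X) a * ((K * avg M (ind T) (a + b)) * (K * avg M (ind X) b)).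
  rewrite -!sumfib big_distrlr /= mulr_sumr; apply: eq_bigr => y _.
  rewrite mulr_sumr; apply: eq_bigr => z _; rewrite /F /G /H.
  have [ey|] := eqVneq (y *m M) _; last by rewrite !mul0r !mulr0.
  have [ez|] := eqVneq (z *m M) _; last by rewrite !mul0r !mulr0.
  have e : (y + z) *m M = a *m M.
    by rewrite mulmxDl ey ez -mulmxDl -addrA addrr_F2 addr0.
  rewrite e eqxx (avg_inv _ e) /ind !mul1r.
  case yT : (y \in T); last by rewrite !(mul0r, mulr0).
  case zX : (z \in X); last by rewrite !(mul0r, mulr0).
  case yzX : (y + z \in X); last by rewrite sub0r !mulr1.
  case/negP: (TX _ yT); apply/imset2P; exists (y + z) z => //.
  by rewrite -addrA addrr_F2 addr0.
move: (avg M (ind X) a) (avg M (ind X) b) (avg M (ind T) (a + b)) lea leb ltT.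
move=> al be ta lea leb ltT le.
have p0 : 0 < K * ta by rewrite mulr_gt0 // (lt_trans e0).
have q0 : 0 < K * be by rewrite mulr_gt0 // (lt_le_trans d0).
have pq0 : 0 < K * ta * (K * be) by exact: mulr_gt0.
(* Cancelling leaves [al ^+ 2 * be * ta <= t], against [al, be >= delta] and [ta > eta]. *)
have : al ^+ 2 * (K * ta * (K * be)) <= t * K ^+ 2.
  by rewrite -(ler_pM2r pq0) -[leLHS]mulrA -expr2; move: le; rewrite exprMn sqrrN.
apply/negP; rewrite -ltNge.
have -> : al ^+ 2 * (K * ta * (K * be)) = (al ^+ 2 * be * ta) * K ^+ 2 by ring.
rewrite ltr_pM2r ?exprn_gt0 //; apply: le_lt_trans let_ _.
apply: (@le_lt_trans _ _ (al ^+ 2 * be * eta)).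
  apply: ler_wpM2r; first exact: ltW.
  have al0 := lt_le_trans d0 lea.
  by rewrite exprSr; apply: ler_pM => //; [exact: sqr_ge0 | exact: ltW |];
    rewrite lerXn2r // nnegrE; exact: ltW.
by rewrite ltr_pM2l // !mulr_gt0 ?exprn_gt0 // (lt_le_trans d0).
Qed.

(** One copy of [A] is trimmed to exactly [2 ^ j] elements to fit [card_sumset_pow2]. *)
Lemma card_sumset_self_pow2 (j : nat) A :
  (2 ^ j < #|A|)%N -> (2 * 2 ^ j <= #|[set (a + b)%R | a in A, b in A]|)%N.
Proof.
move=> ltA; pose B := [set x in take (2 ^ j) (enum A)].
have BE : #|B| = (2 ^ j)%N.
  rewrite cardsE (card_uniqP _) ?take_uniq ?enum_uniq // size_take -cardE.
  by rewrite ltA.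
have BA : B \subset A.
  by apply/fintype.subsetP => x; rewrite inE => /mem_take; rewrite mem_enum.
have := card_sumset_pow2 ltA (B := B); rewrite BE expn_gt0 leqnn => /(_ isT isT).
rewrite mul2n -addnn => /leq_trans; apply; apply: subset_leq_card.
by apply: imset2S.
Qed.

End SumsetStructure.

(* If the cosets on which [X] is unbiased and not sparse cover more than
   [2 ^ j] points, their sums are nearly filled by [X + X]. Otherwise [X] almost
   fills most of them, and the sums with the remaining points of [X] are used
   instead; the single point of [X] beyond [2 ^ j] then matters. *)
Lemma sumset_structure (R : realType) (eta : R) : 0 < eta ->
  exists D : nat, forall n j (X : {set 'rV['F_2]_n}),
    (2 ^ j < #|X|)%N -> eta * (2 ^ n)%:R < (2 ^ j)%:R ->
    exists d (M : 'M['F_2]_(n, d)) (U : {set 'rV['F_2]_n}),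
      [/\ (d <= D)%N, invariant_fun M (mem U),
          2 * (2 ^ j)%:R - eta * (2 ^ n)%:R <= #|U|%:R
        & #|U :\: sumset X|%:R <= eta * (2 ^ n)%:R].
Proof.
(* With this value [2 * delta / eta = eta / 2], so that Markov's inequality below discards at most
   [eta / 2 * N] points. *)
move=> e0; pose delta := eta ^+ 2 / 4.
have d0 : 0 < delta by rewrite divr_gt0 // exprn_gt0.
pose t := delta ^+ 3 * eta.
have t0 : 0 < t by rewrite mulr_gt0 // exprn_gt0.
have [D reg] := regularity t0 d0; exists D => n j X ltX ltj.
have [d [M [leD lebias]]] := reg n (ind X) (ind01 X).
exists d, M; set N : R := (2 ^ n)%:R in ltj lebias *.
have N0 : 0 < N by rewrite ltr0n expn_gt0.
pose f : 'rV['F_2]_n -> R := ind X; pose g := avg M f.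
have g0 x : 0 <= g x by apply: avg_ge0 => y; case/andP: (ind01 (R := R) X y).
pose U0 := [set x | (x \notin biased M f t) && (delta <= g x)].
have invU0 : invariant_fun M (mem U0).
  by move=> x y e; rewrite /= !inE /g (avg_inv _ e) e.
(* At most [delta * N] points of [X] lie in biased cosets and at most [delta * N] in sparse ones. *)
have XU0 : #|X|%:R - 2 * (delta * N) <= #|X :&: U0|%:R.
  pose sp := [set x in X | g x < delta].
  have lesp : #|sp|%:R <= delta * N.
    have -> : #|sp|%:R = \sum_x f x * (g x < delta)%R%:R :> R.
      rewrite -sum_ind; apply: eq_bigr => x _.
      by rewrite /ind inE /f /ind -natrM mulnb.
    rewrite -(@avg_dual _ _ _ M); last by move=> x y e; rewrite /g (avg_inv _ e).
    rewrite /N -card_rowF2 mulr_natr -sumr_const; apply: ler_sum => x _.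
    case: ltP => [|_]; last by rewrite mulr0 ltW.
    by rewrite mulr1; exact: ltW.
  have : (#|X| <= #|X :&: U0| + (#|biased M f t| + #|sp|))%N.
    rewrite -(cardsID U0 X) leq_add2l.
    apply: leq_trans (leq_card_setU _ _); apply: subset_leq_card.
    apply/fintype.subsetP => x; rewrite !inE => /andP[nU xX]; move: nU.
    by rewrite xX negb_and negbK -ltNge.
  by rewrite -(ler_nat R) !natrD; lra.
have missing (U : {set 'rV['F_2]_n}) : invariant_fun M (mem U) ->
    (forall x, x \in U -> avg M (ind (U :\: sumset X)) x <= eta) ->
    #|U :\: sumset X|%:R <= eta * N.
  move=> invU le; apply: (@avg_ind_bound _ _ _ M) => x.
  have [/le //|xU] := boolP (x \in U).
  rewrite /avg big1 ?mul0r ?ltW // => y /eqP e.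
  rewrite /ind inE; have -> : y \in U = false; last by rewrite andbF.
  by rewrite -[LHS](invU x y) //; exact: negbTE.
have [lt0|le0] := ltnP (2 ^ j) #|U0|.
  exists [set a + b | a in U0, b in U0].
  have invU := invariant_sumset U0 invU0; split=> //.
    have := card_sumset_self_pow2 lt0; rewrite -(ler_nat R) natrM.
    have := mulr_gt0 e0 N0; lra.
  apply: missing => // x /imset2P[a b].
  rewrite inE => /andP[nba lea]; rewrite inE => /andP[nbb leb] ->.
  apply: (avg_sumset_compl d0 e0 (lexx _) _ nba lea leb) => y.
  by rewrite inE => /andP[].
pose U1 := [set x in U0 | 1 - eta <= g x].
have invU1 : invariant_fun M (mem U1).
  by move=> x y e; rewrite /= !inE /g (avg_inv _ e) e.
have sub10 : U1 \subset U0 by apply/fintype.subsetP => x; rewrite inE => /andP[].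
have leX : (2 ^ j)%:R <= #|X|%:R :> R by rewrite ler_nat ltnW.
have leU0 : #|U0|%:R <= (2 ^ j)%:R :> R by rewrite ler_nat.
(* Markov's inequality: as [#|U0| <= 2 ^ j < #|X|], [X] misses at most [2 * delta * N] points of
   [U0], but more than a share [eta] of each coset in [U0 :\: U1]. *)
have le01 : eta * #|U0 :\: U1|%:R <= 2 * (delta * N).
  apply: (@le_trans _ _ (\sum_x (1 - g x) * ind U0 x)).
    rewrite -sum_ind mulr_sumr; apply: ler_sum => x _.
    have g1 : g x <= 1 by apply: avg_le1 => y; case/andP: (ind01 (R := R) X y).
    rewrite /ind finset.in_setD [x \in U1]inE; case: (x \in U0); last first.
      by rewrite andbF !mulr0.
    rewrite andbT mulr1 /=; have [_|?] := leP (1 - eta) (g x); rewrite /= ?mulr0 ?mulr1; lra.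
  under eq_bigr do rewrite mulrBl mul1r; rewrite sumrB sum_ind avg_dual.
    have -> : \sum_x f x * ind U0 x = #|X :&: U0|%:R.
      by rewrite -sum_ind; apply: eq_bigr => x _; rewrite /f /ind finset.in_setI -natrM mulnb.
    lra.
  by move=> x y e; congr (nat_of_bool _)%:R; exact: invU0.
have leU1 : (2 ^ j)%:R - eta * N <= #|U1|%:R.
  have := cardsID U1 U0; rewrite (finset.setIidPr sub10) => /(congr1 (fun k => k%:R : R)).
  rewrite natrD => cU.
  have le2 : #|U0 :\: U1|%:R <= eta / 2 * N.
    rewrite -(ler_pM2l e0); apply: le_trans le01 _.
    by rewrite /delta le_eqVlt; apply/orP; left; apply/eqP; field.
  have : #|X :&: U0|%:R <= #|U0|%:R :> R by rewrite ler_nat subset_leq_card // subsetIr.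
  move=> leI.
  have e1 : eta <= 1.
    rewrite -(ler_pM2r N0) mul1r; apply/ltW/(lt_le_trans ltj)/(le_trans leX).
    by rewrite ler_nat -card_rowF2 max_card.
  have : 2 * (delta * N) <= eta / 2 * N.
    rewrite mulrA ler_pM2r // /delta.
    have : eta * eta <= eta by rewrite ler_piMr // ltW.
    rewrite expr2; lra.
  lra.
exists [set a + b | a in X, b in U1].
have invU := invariant_sumset X invU1; split=> //.
  (* [U1] is nonempty because [eta * N < 2 ^ j]. *)
  have U1gt0 : (0 < #|U1|)%N by rewrite -(ltr_nat R); lra.
  have leU1j : (#|U1| <= 2 ^ j)%N by apply: leq_trans le0; exact: subset_leq_card.
  have := card_sumset_pow2 ltX U1gt0 leU1j; rewrite -(ler_nat R) natrD; lra.
apply: missing => // x /imset2P[a u aX]; rewrite inE => /andP[_ leu] ->.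
(* If [y] is missing then [y + a] is not in [X], and [y + a] runs over the coset of [u], which [X]
   nearly fills. *)
apply: (@le_trans _ _ (avg M (fun y => 1 - f (y + a)) (a + u))).
  apply: le_avg => y _; rewrite /f /ind inE.
  case yS : (y \in sumset X) => /=.
    by rewrite subr_ge0 lern1 leq_b1.
  case yaX : (y + a \in X); last by rewrite subr0 lern1 leq_b1.
  move/negP: yS; case; apply/imset2P; exists (y + a) a => //.
  by rewrite -addrA addrr_F2 addr0.
rewrite (avg_shift M (fun y => 1 - f y)) addrAC addrr_F2 add0r.
have -> : avg M (fun y => 1 - f y) u = 1 - g u.
  rewrite -[X in _ = X - _](avg_cst M 1 u) /g /avg -mulrBl; congr (_ / _); exact: sumrB.
by rewrite lerBlDr -lerBlDl.
Qed.

(** * Counting *)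

(** Zero columns pad the width to [D], so that [U] is coded by one matrix and one subset of a space
    independent of [n]. *)
Lemma invariant_preimage n d D (M : 'M['F_2]_(n, d)) (U : {set 'rV['F_2]_n}) :
  (d <= D)%N -> invariant_fun M (mem U) ->
  exists (M' : 'M['F_2]_(n, D)) (S : {set 'rV['F_2]_D}),
    U = [set x | x *m M' \in S].
Proof.
move=> leD invU; rewrite -(subnKC leD).
pose M' : 'M['F_2]_(n, d + (D - d)) := row_mx M 0.
exists M', [set x *m M' | x in U]; apply/setP => x; rewrite inE.
apply/idP/imsetP => [xU|[y yU]]; first by exists x.
rewrite !mul_mx_row => /eq_row_mx[e _].
by have /= -> := invU _ _ e.
Qed.

(** Expanding [(1 + x) ^ #|T|] over all subsets, each small one contributes at least [x ^ m]. *)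
Lemma card_small_sets (R : realFieldType) (T : finType) (x : R) (m : nat) :
  0 < x -> x <= 1 ->
  #|[set A : {set T} | (#|A| <= m)%N]|%:R <= (1 + x) ^+ #|T| / x ^+ m.
Proof.
move=> x0 x1; rewrite ler_pdivlMr ?exprn_gt0 //.
have -> : (1 + x) ^+ #|T| = \sum_(A : {set T}) x ^+ #|A|.
  rewrite -prodr_const (eq_bigr (fun=> x + 1)) => [|i _]; last exact: addrC.
  rewrite (bigA_distr 1) big_mkcond; apply: eq_bigr => A _.
  by rewrite -prodr_const [RHS]big_mkcond.
rewrite mulrC mulr_natr -sumr_const big_mkcond; apply: ler_sum => A _.
rewrite inE; case: ifP => [le|_]; last by rewrite exprn_ge0 // ltW.
by apply: ler_wiXn2l => //; exact: ltW.
Qed.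

Lemma ln2_ge_half (R : realType) : 1 / 2 <= ln 2 :> R.
Proof.
have : ln (1 + (- (1 / 2))) <= - (1 / 2) :> R by apply: le_ln1Dx; lra.
have -> : 1 + (- (1 / 2)) = 2^-1 :> R by lra.
by rewrite lnV ?posrE // lerN2.
Qed.

(** In the bound of [card_small_sets] with [x = 2 ^- q], the factors [(1 + x) ^ N <= exp (x * N)]
    and [x ^- m = 2 ^ (q * m)] each get half the exponent. The cap [c] lets [eta] be shrunk
    further. *)
Lemma few_small_sets (R : realType) (eps c : R) : 0 < eps -> 0 < c ->
  exists2 eta : R, 0 < eta <= c & forall T : finType,
    #|[set A : {set T} | (#|A|%:R <= eta * #|T|%:R)%R]|%:R <= 2 `^ (eps * #|T|%:R).
Proof.
move=> e0 c0; pose q := (Num.truncn (4 / eps)).+1.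
have q0 : 0 < q%:R :> R by rewrite ltr0n.
have ltq : 4 / eps < q%:R by exact: truncnS_gt.
pose x : R := (2 ^+ q)^-1.
have p20 : 0 < 2 ^+ q :> R by rewrite exprn_gt0.
have x0 : 0 < x by rewrite invr_gt0.
have x1 : x <= 1 by rewrite invf_le1 // exprn_ege1 // ler1n.
have lex : x <= eps / 4.
  rewrite -[leRHS]invrK lef_pV2 ?posrE ?invr_gt0 ?divr_gt0 // invf_div.
  apply/ltW/(lt_trans ltq); rewrite -natrX ltr_nat; exact: ltn_expl.
exists (Num.min c (eps / (2 * q%:R))).
  by rewrite lt_min c0 ge_min lexx /= !(mulr_gt0, divr_gt0, invr_gt0).
set eta := Num.min _ _ => T; set N : R := #|T|%:R.
have N0 : 0 <= N by rewrite ler0n.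
have eta0 : 0 <= eta.
  by rewrite le_min ltW //= ltW // !(mulr_gt0, divr_gt0, invr_gt0).
have eN0 : 0 <= eta * N by exact: mulr_ge0.
have etaq : q%:R * eta <= eps / 2.
  apply: (@le_trans _ _ (q%:R * (eps / (2 * q%:R)))).
    by rewrite ler_pM2l // ge_min lexx orbT.
  by rewrite le_eqVlt; apply/orP; left; apply/eqP; field; rewrite pnatr_eq0.
pose m := Num.truncn (eta * N).
have -> : [set A : {set T} | #|A|%:R <= eta * N] = [set A : {set T} | (#|A| <= m)%N].
  by apply/setP => A; rewrite !inE truncn_ge_nat.
apply: le_trans (card_small_sets _ _ x0 x1) _.
rewrite -exprVn invrK -exprM /powR pnatr_eq0 /=.
have -> : 2 ^+ (q * m) = expR ((q * m)%:R * ln 2) :> R.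
  by rewrite expRM_natl lnK // posrE.
have l2 := ln2_ge_half R.
apply: (@le_trans _ _ (expR (x * N) * expR ((q * m)%:R * ln 2))).
  rewrite ler_wpM2r ?expR_ge0 // [x * N]mulrC expRM_natl.
  apply: lerXn2r; rewrite ?nnegrE ?expR_ge0 ?expR_ge1Dx //.
  by rewrite addr_ge0 // ltW.
rewrite -expRD ler_expR natrM.
have lem : m%:R <= eta * N by rewrite truncn_le.
apply: (@le_trans _ _ (eps / 2 * N * ln 2 + eps / 2 * N * ln 2)); last lra.
(* As [ln 2 >= 1 / 2], [x * N <= 2 * x * N * ln 2 <= eps / 2 * N * ln 2]. *)
apply: lerD.
  have : 0 <= x * N * (ln 2 - 1 / 2) by rewrite !mulr_ge0 ?subr_ge0 // ltW.
  have : 0 <= (eps / 4 - x) * N * ln 2.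
    rewrite !mulr_ge0 ?subr_ge0 //; lra.
  lra.
apply: ler_wpM2r; first lra.
apply: (@le_trans _ _ (q%:R * (eta * N))); first by rewrite ler_pM2l.
by rewrite mulrA ler_wpM2r.
Qed.

(** Follows from [(n + 1) ^ 2 <= 4 * 2 ^ n]; it makes matrices and unions of cosets negligible in
    the count. *)
Lemma linear_le_pow2 (R : realType) (C : nat) (e : R) : 0 < e ->
  exists n0 : nat, forall n, (n0 <= n)%N -> (n.+1 * C)%:R <= e * (2 ^ n)%:R.
Proof.
move=> e0; exists (Num.truncn (4 * C%:R / e)) => n le.
have sq : (n.+1 ^ 2 <= 4 * 2 ^ n)%N.
  elim: n {le} => [//|[//|[//|n]] IH]; rewrite [(2 ^ _.+1)%N]expnS; nia.
have : 4 * C%:R / e < n.+1%:R.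
  by apply: lt_le_trans (truncnS_gt _) _; rewrite ler_nat.
rewrite ltr_pdivrMr // => lt.
have : n.+1%:R * (4 * C%:R) <= n.+1%:R * (n.+1%:R * e) :> R by rewrite ler_pM2l ?ltr0n // ltW.
move: sq; rewrite -(ler_nat R) natrX natrM => sq.
have : e * n.+1%:R ^+ 2 <= e * (4 * (2 ^ n)%:R) by rewrite ler_pM2l.
rewrite natrM expr2; lra.
Qed.

(** * The family of coded sets: unions of cosets minus small sets *)

Theorem theorem4p1 (R : realType) (eps : R) (eps_gt0 : 0 < eps) :
  exists n0 : nat, forall n : nat, (n0 <= n)%N ->
  forall N : nat, N = (2 ^ n)%N ->
  forall k : nat, eps * N%:R <= k%:R -> (k <= N)%N ->
  forall k' : nat, (exists j : nat, k' = (2 ^ j)%N) ->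
    (k' < k)%N -> (k <= 2 * k')%N ->
  exists F : {set {set 'rV['F_2]_n}},
    [/\ #|F|%:R <= 2 `^ (eps * N%:R),
        forall A : {set 'rV['F_2]_n}, A \in F -> (2 - eps) * k'%:R <= #|A|%:R
      & forall X : {set 'rV['F_2]_n}, #|X| = k ->
          exists2 A : {set 'rV['F_2]_n}, A \in F & A \subset sumset X].
Proof.
have eps2 : 0 < eps / 2 by lra.
(* Two errors of [eta * N] occur, in the size of [U] and in its missing part; as
   [eps * N <= 2 * k'], this cap keeps their sum below [eps * k'] or equal to it. *)
have c0 : 0 < eps ^+ 2 / 4 by rewrite divr_gt0 // exprn_gt0.
have [eta /andP[eta0 etac] few] := few_small_sets eps2 c0.
have [D struct] := sumset_structure eta0.
(* The exponents [n * D] for matrices and [2 ^ D] for sets of cosets fit in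
   [(n + 1) * (D + 2 ^ D)]. *)
have [n0 large] := linear_le_pow2 (D + 2 ^ D) eps2.
exists n0 => n len N -> k lek leN k' [j ->] ltk lek2.
have {}large := large n len.
set NR : R := (2 ^ n)%:R in lek large *.
have NR0 : 0 < NR by rewrite ltr0n expn_gt0.
have eps1 : eps <= 1.
  by rewrite -(ler_pM2r NR0) mul1r; apply: le_trans lek _; rewrite ler_nat.
have lek' : eps * NR <= 2 * (2 ^ j)%:R.
  by apply: le_trans lek _; rewrite -natrM ler_nat.
have etaN : eta * NR <= eps * (eps * NR) / 4.
  have : eta * NR <= eps ^+ 2 / 4 * NR by rewrite ler_pM2r.
  rewrite expr2; lra.
have epsk : eps * (eps * NR) <= eps * (2 * (2 ^ j)%:R) by rewrite ler_pM2l.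
pose small := [set T : {set 'rV['F_2]_n} | #|T|%:R <= eta * NR].
pose code (p : 'M['F_2]_(n, D) * {set 'rV['F_2]_D} * {set 'rV['F_2]_n}) :=
  [set x | x *m p.1.1 \in p.1.2] :\: p.2.
pose F := [set A in [set code p | p in finset.setX [set: _] small] |
           (2 - eps) * (2 ^ j)%:R <= #|A|%:R].
exists F; split; last 1 first.
- move=> X cX; rewrite -cX in ltk.
  have ltj : eta * NR < (2 ^ j)%:R.
    have : eps * (eps * NR) <= 1 * (eps * NR) by rewrite ler_wpM2r // mulr_ge0 // ltW.
    have := mulr_gt0 eps_gt0 NR0; lra.
  have [d [M [U [leD invU geU misU]]]] := struct n j X ltk ltj.
  have [M' [S US]] := invariant_preimage leD invU.
  (* Removing from [U] its missing points leaves a subset of [X + X] in coded form. *)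
  exists (U :&: sumset X); last exact: subsetIr.
  have UE : U :&: sumset X = U :\: (U :\: sumset X).
    by apply/setP => x; rewrite !inE; case: (x \in U); rewrite ?andbF ?andbT ?negbK.
  rewrite inE; apply/andP; split.
    rewrite UE; apply/imsetP; exists (M', S, U :\: sumset X).
      by rewrite !inE /= misU.
    by rewrite /code /= -US.
  have := cardsID (sumset X) U => /(congr1 (fun i => i%:R : R)).
  rewrite natrD -/NR in geU misU *; lra.
- have cardF : (#|F| <= 2 ^ (n.+1 * (D + 2 ^ D)) * #|small|)%N.
    apply: (@leq_trans #|finset.setX [set: 'M['F_2]_(n, D) * {set 'rV['F_2]_D}] small|).
      apply: leq_trans (leq_imset_card code _); apply: subset_leq_card.
      by apply/fintype.subsetP => A; rewrite inE => /andP[].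
    have cS : #|{: {set 'rV['F_2]_D}}| = (2 ^ 2 ^ D)%N.
      by rewrite -cardsT -powersetT card_powerset cardsT card_rowF2.
    rewrite cardsX leq_mul2r cardsT card_prod card_mx card_Fp // cS.
    rewrite -expnD leq_exp2l // mulnDr leq_add ?orbT //.
      by rewrite leq_mul2r leqnSn orbT.
    by rewrite leq_pmull.
  apply: (@le_trans _ _ ((2 ^ (n.+1 * (D + 2 ^ D)) * #|small|)%N%:R)).
    by rewrite ler_nat.
  (* Half the exponent pays for the matrix and the set of cosets, half for the small set. *)
  have -> : eps * NR = eps / 2 * NR + eps / 2 * NR by lra.
  rewrite powRD; last by apply/implyP => _; rewrite pnatr_eq0.
  rewrite natrM; apply: ler_pM => //.
    by rewrite natrX -powR_mulrn // ler_powR // ler1n.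
  by have := few 'rV['F_2]_n; rewrite card_rowF2.
- by move=> A; rewrite inE => /andP[].
Qed.
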